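(* Let $E \subseteq \mathbb{R}^n$ be open and convex, and consider the optimization problem $\min_{x\in E} f(x)$, where $f\colon E\to\mathbb{R}$ is $C^1$, $\gamma$-smooth ($\gamma>0$) and has a unique global minimizer $x^*\in E$. Let $\eta>0$ and, for $x\in E$, let $\tilde x := x-\eta\nabla f(x)\in\mathbb{R}^n$ be the result of one step of gradient descent with step size $\eta$ starting from $x$. Suppose there is a constant $0<c\le 1$ such that for every $x\in E$ $$\|\tilde x-x^*\|^2\le (1-c)\,\|x-x^*\|^2 .$$ Then $f$ is weak-strongly-convex on $E$ with parameters $$a:=\frac{1}{2\gamma\eta}\,\frac{c}{1-\sqrt{c}/2}=\Omega\!\left(\frac{c}{\gamma\eta}\right),\qquad \mu:=\frac{\gamma}{2}=\Omega(\gamma),$$ that is, for every $x\in E$, $$f(x)-f(x^* )\le \frac1a\langle\nabla f(x),x-x^*\rangle-\frac{\mu}{2}\|x-x^*\|^2 .$$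
   Context: $\langle\cdot,\cdot\rangle$ and $\|\cdot\|$ are the Euclidean inner product and norm on $\mathbb{R}^n$. A $C^1$ function $f:E\to\mathbb{R}$ is $\gamma$-smooth if $\|\nabla f(x)-\nabla f(y)\|\le\gamma\|x-y\|$ for all $x,y\in E$. A (lower bounded) function $f:E\to\mathbb{R}$ on an open convex set $E\subseteq\mathbb{R}^n$ is weak-strongly-convex if there are constants $a,\mu>0$ such that for any global minimizer $x^*$ of $f$ and any $x\in E$, $f(x)-f(x^* )\le\frac1a\langle\nabla f(x),x-x^*\rangle-\frac\mu2\|x-x^*\|^2$. $\Omega(\cdot)$ denotes a lower bound up to an absolute positive multiplicative constant. *)

(* Defs.v *)
From mathcomp Require Import all_boot all_order all_algebra.
From mathcomp Require Import all_classical all_reals all_analysis.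

Set Implicit Arguments.
Unset Strict Implicit.
Unset Printing Implicit Defensive.

Import Order.TTheory GRing.Theory Num.Theory.
Import numFieldNormedType.Exports.

Local Open Scope classical_set_scope.
Local Open Scope ring_scope.

Section Euclidean.
Context {R : realType} {n : nat}.
Implicit Types u v : 'rV[R]_n.

Definition dotv u v : R := \sum_(i < n) u ord0 i * v ord0 i.

(* The library's norm `|u| on 'rV[R]_n is the sup norm; it induces the same
   topology and the same notion of differentiability, but smoothness constants
   must be measured with the Euclidean norm. *)
Definition enorm u : R := Num.sqrt (dotv u u).

Implicit Types (f : 'rV[R]_n -> R) (E : set 'rV[R]_n).

Definition gradient f (x : 'rV[R]_n) : 'rV[R]_n :=
  \row_(i < n) 'D_(delta_mx ord0 i) f x.

(* A function E -> R is represented by a total function whose values outside E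
   are irrelevant: as E is open in all uses, differentiability and gradients at
   points of E, and continuity there, depend only on the restriction to E. *)
Definition C1_on E f : Prop :=
  forall x, E x -> differentiable f x /\ {for x, continuous (gradient f)}.

Definition smooth_on E (gamma : R) f : Prop :=
  forall x y, E x -> E y ->
    enorm (gradient f x - gradient f y) <= gamma * enorm (x - y).

Definition global_minimizer E f (x : 'rV[R]_n) : Prop :=
  E x /\ forall y, E y -> f x <= f y.

Definition weak_strongly_convex E (a mu : R) f : Prop :=
  [/\ has_lbound (f @` E), 0 < a, 0 < mu &
   forall xs x, global_minimizer E f xs -> E x ->
     f x - f xs <=
       a^-1 * dotv (gradient f x) (x - xs) - mu / 2 * enorm (x - xs) ^+ 2].

Definition gd_step f (eta : R) (x : 'rV[R]_n) : 'rV[R]_n :=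
  x - eta *: gradient f x.

End Euclidean.

(* Main.v *)
Require Import Defs.
From mathcomp Require Import all_boot all_order all_algebra.
From mathcomp Require Import all_classical all_reals all_analysis.
From mathcomp Require Import ring lra.

Import Order.TTheory GRing.Theory Num.Theory.
Import numFieldNormedType.Exports.

Local Open Scope classical_set_scope.
Local Open Scope ring_scope.

(** Write [d := x - xs], [D := |d|^2], [g] for the gradient at [x] and
    [p := eta * <g, d>].

    Smoothness gives an upper bound on the left-hand side.  At [xs] itself the
    contraction hypothesis says that the gradient step does not move, so the
    gradient vanishes there; the descent inequality (integrate
    [<grad f (xs + t d), d> <= gamma * t * D] over [0 <= t <= 1], see
    [smooth_growth_at_critical_point]) then yields
    [f x - f xs <= gamma / 2 * D].  Hence it suffices to show
    [3 / 4 * gamma * D <= a^-1 * <g, d>].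

    Expanding the square in the contraction hypothesis gives
    [eta^2 * |g|^2 - 2 * p + c * D <= 0], and Cauchy-Schwarz turns it into the
    scalar condition [p^2 - 2 * p * D + c * D^2 <= 0]
    ([contraction_quadratic]).  With [s := sqrt c], so that
    [a^-1 = gamma * eta * (2 - s) / s^2], the goal reads
    [3 / 4 * s^2 * D <= (2 - s) * p], which is the elementary inequality
    [contraction_rate_bound].  It is sharp, with equality at [s = 4 / 5] and
    [p = 2 / 5 * D]: the constant [3 / 4] leaves no slack in [a]. *)

(** * The Euclidean inner product *)

Section EuclideanProduct.
Context {R : realType} {n : nat}.
Implicit Types u v w : 'rV[R]_n.

Lemma dotvC u v : dotv u v = dotv v u.
Proof. by apply: eq_bigr => i _; rewrite mulrC. Qed.

Lemma dotvDl u v w : dotv (u + v) w = dotv u w + dotv v w.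
Proof. by rewrite -big_split; apply: eq_bigr => i _; rewrite mxE mulrDl. Qed.

Lemma dotvZl (k : R) u v : dotv (k *: u) v = k * dotv u v.
Proof. by rewrite mulr_sumr; apply: eq_bigr => i _; rewrite mxE mulrA. Qed.

Lemma dotvNl u v : dotv (- u) v = - dotv u v.
Proof. by rewrite -scaleN1r dotvZl mulN1r. Qed.

Lemma dotv_ge0 u : 0 <= dotv u u.
Proof. by apply: sumr_ge0 => i _; rewrite -expr2 sqr_ge0. Qed.

Lemma dotv_eq0 u : dotv u u = 0 -> u = 0.
Proof.
move=> /eqP; rewrite psumr_eq0; last by move=> i _; rewrite -expr2 sqr_ge0.
move=> /allP u0; apply/rowP => i; rewrite mxE; apply/eqP.
by have := u0 i (mem_index_enum i); rewrite /= mulf_eq0 orbb.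
Qed.

Lemma enorm_sqr u : enorm u ^+ 2 = dotv u u.
Proof. by rewrite sqr_sqrtr // dotv_ge0. Qed.

Lemma enormZ (k : R) u : 0 <= k -> enorm (k *: u) = k * enorm u.
Proof.
move=> k0; rewrite /enorm dotvZl dotvC dotvZl mulrA -expr2.
by rewrite sqrtrM ?sqr_ge0 // sqrtr_sqr ger0_norm.
Qed.

Lemma dotv_sqr_subZ u v (k : R) :
  dotv (u - k *: v) (u - k *: v)
  = dotv u u - 2 * k * dotv v u + k ^+ 2 * dotv v v.
Proof.
rewrite dotvDl dotvNl dotvZl !(dotvC _ (u - _)) !dotvDl !dotvNl !dotvZl.
by rewrite (dotvC u v); ring.
Qed.

Lemma dotv_CauchySchwarz u v : dotv u v ^+ 2 <= dotv u u * dotv v v.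
Proof.
have [v0|v0] := eqVneq (dotv v v) 0.
  by rewrite v0 (dotv_eq0 _ v0) dotvC -(scale0r 0) dotvZl mul0r expr0n mulr0.
have vgt0 : 0 < dotv v v by rewrite lt_def v0 dotv_ge0.
(* the residual of the orthogonal projection of u on v *)
have := dotv_ge0 (u - (dotv u v / dotv v v) *: v).
rewrite dotv_sqr_subZ (dotvC v u) => h.
rewrite -subr_ge0 -(pmulr_lge0 _ (x := (dotv v v)^-1)) ?invr_gt0 //.
by move: h; congr (0 <= _); field.
Qed.

Lemma dotv_le_enorm u v : dotv u v <= enorm u * enorm v.
Proof.
rewrite /enorm -sqrtrM ?dotv_ge0 //; apply: le_trans (ler_norm _) _.
by rewrite -sqrtr_sqr ler_wsqrtr // dotv_CauchySchwarz.
Qed.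

End EuclideanProduct.

(** * Growth of a smooth function around a critical point *)

Section Growth.
Context {R : realType} {n : nat}.
Implicit Types (f : 'rV[R]_n -> R) (E : set 'rV[R]_n) (x d : 'rV[R]_n).

Lemma derive_gradient f x d :
  differentiable f x -> 'D_d f x = dotv (gradient f x) d.
Proof.
move=> fx; rewrite (deriveE _ fx) {1}(row_sum_delta d) linear_sum.
apply: eq_bigr => i _; rewrite linearZ mxE (deriveE _ fx).
by rewrite mulrC.
Qed.

Lemma is_derive_line f x d (t : R) : differentiable f (x + t *: d) ->
  is_derive t 1 (fun s => f (x + s *: d)) (dotv (gradient f (x + t *: d)) d).
Proof.
move=> fxt; rewrite -derive_gradient //.
(* both difference quotients are the same function of h *)
have quotE : (fun h : R => h^-1 *: (f (x + (h *: (1 : R) + t) *: d)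
                                    - f (x + t *: d)))
    = (fun h : R => h^-1 *: (f (h *: d + (x + t *: d)) - f (x + t *: d))).
  apply/funext => h; congr (_ *: (f _ - _)).
  by rewrite [h *: 1]mulr1 scalerDl addrCA.
have fd : derivable f (x + t *: d) d by exact: diff_derivable.
split; first by rewrite /derivable /= quotE.
by rewrite /derive /= quotE.
Qed.

Lemma convex_set_line E x d (t : R) :
  convex_set (E : set (convex_lmodType 'rV[R]_n)) ->
  E x -> E (x + d) -> 0 <= t <= 1 -> E (x + t *: d).
Proof.
move=> cE Ex Exd /andP[t0 t1].
pose l : {i01 R} := Itv01 t0 t1.
have := cE (x + d) x l (mem_set Exd) (mem_set Ex).
rewrite inE; congr (E _).
change (t *: (x + d) + (1 - t) *: x = x + t *: d).
by rewrite scalerDr scalerBl scale1r addrC subrKA addrC.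
Qed.

(** The descent inequality at a point where the linear term vanishes: along the
    segment from [x] to [x + d] the slope at time [t] is at most
    [gamma * t * |d|^2], so [f (x + t d) - gamma / 2 * t^2 * |d|^2] does not
    increase. *)
Lemma smooth_growth_at_critical_point E f (gamma : R) x d :
  convex_set (E : set (convex_lmodType 'rV[R]_n)) ->
  (forall y, E y -> differentiable f y) -> smooth_on E gamma f ->
  E x -> E (x + d) -> gradient f x = 0 ->
  f (x + d) - f x <= gamma / 2 * enorm d ^+ 2.
Proof.
move=> cE df sf Ex Exd gx0.
pose psi (t : R) := f (x + t *: d) - gamma / 2 * enorm d ^+ 2 * t ^+ 2.
pose dpsi (t : R) :=
  dotv (gradient f (x + t *: d)) d - gamma * enorm d ^+ 2 * t.
have Et t : t \in `[(0 : R), 1] -> E (x + t *: d).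
  by rewrite in_itv; apply: convex_set_line.
have psi' t : t \in `[(0 : R), 1] -> is_derive t 1 psi (dpsi t).
  move=> t01; have lin := is_derive_line _ _ _ _ (df _ (Et _ t01)).
  have quad : is_derive t (1 : R)
      (fun s : R => gamma / 2 * enorm d ^+ 2 * s ^+ 2)
      (gamma * enorm d ^+ 2 * t).
    apply: is_derive_eq; rewrite /= ?scaler0 ?expr1.
    by rewrite /GRing.scale /=; field.
  exact: is_deriveB.
have psi'oo t : t \in `](0 : R), 1[ -> is_derive t 1 psi (dpsi t).
  by move=> t01; have := psi' t (subset_itv_oo_cc t01).
have psic : {within `[(0 : R), 1], continuous psi}.
  by apply: derivable_within_continuous => t /psi'[].
have [t t01 psi1] := @MVT R psi dpsi 0 1 ltr01 psi'oo psic.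
have {t01} t01 : t \in `[(0 : R), 1] by apply: subset_itv_oo_cc.
have t0 : 0 <= t by move: t01; rewrite in_itv => /andP[].
have dpsi_le0 : dpsi t <= 0.
  rewrite subr_le0; apply: le_trans (dotv_le_enorm _ _) _.
  have := sf _ _ (Et _ t01) Ex.
  rewrite gx0 subr0 [x + _]addrC addrK (enormZ _ _ t0) => gle.
  have d0 : 0 <= enorm d by exact: sqrtr_ge0.
  by have := ler_wpM2r d0 gle; lra.
move: psi1; rewrite /psi scale1r scale0r addr0 => psi1.
nra.
Qed.

End Growth.

(** * The consequences of contraction *)

Section Contraction.
Context {R : realType}.

(** The square of the contracted distance, expanded, with [|g|^2] eliminated by
    Cauchy-Schwarz: what remains constrains only the inner product. *)
Lemma contraction_quadratic {n : nat} (g d : 'rV[R]_n) (eta c : R) :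
  0 <= c -> enorm (d - eta *: g) ^+ 2 <= (1 - c) * enorm d ^+ 2 ->
  let p := eta * dotv g d in
  let D := enorm d ^+ 2 in
  0 <= p /\ p ^+ 2 - 2 * p * D + c * D ^+ 2 <= 0.
Proof.
rewrite !enorm_sqr dotv_sqr_subZ => c0 con p D.
have D0 : 0 <= D by exact: dotv_ge0.
have eg0 : 0 <= eta ^+ 2 * dotv g g by rewrite mulr_ge0 ?sqr_ge0 ?dotv_ge0.
have {}con : eta ^+ 2 * dotv g g + c * D <= 2 * p.
  by rewrite /p /D; lra.
have CS : p ^+ 2 <= (eta ^+ 2 * dotv g g) * D.
  rewrite /p /D exprMn -mulrA ler_wpM2l ?sqr_ge0 //.
  exact: dotv_CauchySchwarz.
by split; nra.
Qed.

(** In terms of [r := p / D], the hypothesis is [s^2 <= 2 * r - r^2].  Since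
    [(1 / 2 + 3 / 4 * r)^2 - (2 * r - r^2) = (1 / 2 - 5 / 4 * r)^2], this forces
    [s <= 1 / 2 + 3 / 4 * r], and then
    [(2 - s) * r >= 3 / 4 * (2 * r - r^2) >= 3 / 4 * s^2]. *)
Lemma contraction_rate_bound (s p D : R) :
  0 <= D -> 0 <= p -> p ^+ 2 - 2 * p * D + s ^+ 2 * D ^+ 2 <= 0 ->
  3 / 4 * s ^+ 2 * D <= (2 - s) * p.
Proof.
move=> D0 p0 q.
have [D00|Dneq0] := eqVneq D 0.
  move: q; rewrite D00 => q.
  have p00 : p = 0.
    by apply/eqP; rewrite -sqrf_eq0 eq_le sqr_ge0 andbT; nra.
  by rewrite p00 !mulr0.
have Dgt0 : 0 < D by rewrite lt_def Dneq0.
have sD_le : s * D <= D / 2 + 3 / 4 * p.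
  have rhs0 : 0 <= D / 2 + 3 / 4 * p by lra.
  apply: le_trans (ler_norm _) _.
  rewrite -(ger0_norm rhs0) -ler_sqr ?nnegrE //.
  rewrite !real_normK ?num_real //.
  by have := sqr_ge0 (D / 2 - 5 / 4 * p); nra.
rewrite -(ler_pM2r Dgt0).
by have := ler_wpM2r p0 sD_le; nra.
Qed.

End Contraction.

(* K is the absolute constant hidden in the two Omega's, hence quantified
   before all the data of the problem. *)
Theorem theorem5 (R : realType) :
  exists2 K : R, 0 < K &
  forall (n : nat) (E : set 'rV[R]_n) (f : 'rV[R]_n -> R)
         (gamma eta c : R) (xs : 'rV[R]_n),
    open E ->
    convex_set (E : set (convex_lmodType 'rV[R]_n)) ->
    C1_on E f ->
    0 < gamma ->
    smooth_on E gamma f ->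
    unique (global_minimizer E f) xs ->
    0 < eta ->
    0 < c <= 1 ->
    (forall x, E x ->
       enorm (gd_step f eta x - xs) ^+ 2 <= (1 - c) * enorm (x - xs) ^+ 2) ->
    let a := 1 / (2 * gamma * eta) * (c / (1 - Num.sqrt c / 2)) in
    let mu := gamma / 2 in
    [/\ weak_strongly_convex E a mu f,
        K * (c / (gamma * eta)) <= a
      & K * gamma <= mu].
Proof.
exists (1 / 2); first by lra.
move=> n E f gamma eta c xs _ cE C1f gamma0 sf [[Exs minxs] uxs] eta0.
move=> /andP[c0 c1] contr a mu.
set s := Num.sqrt c in a *.
have cE2 : c = s ^+ 2 by rewrite sqr_sqrtr // ltW.
have s0 : 0 < s by rewrite sqrtr_gt0.
have s1 : s <= 1 by rewrite -sqrtr1 ler_wsqrtr.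
have den0 : 0 < 1 - s / 2 by lra.
have ge0 : 0 < gamma * eta by exact: mulr_gt0.
have a0 : 0 < a.
  rewrite mulr_gt0 ?divr_gt0 //.
  by rewrite -mulrA mulr_gt0.
have grad0 : gradient f xs = 0.
  (* at xs the contraction reads |eta * gradient f xs|^2 <= 0 *)
  have := contr _ Exs; rewrite /gd_step subrr addrC addKr !enorm_sqr.
  rewrite -scaleNr dotvZl dotvC dotvZl mulrA mulrNN -expr2.
  rewrite -(scale0r 0) dotvZl mul0r mulr0 pmulr_rle0 ?exprn_gt0 // => g0.
  by rewrite scale0r; apply: dotv_eq0; apply/eqP; rewrite eq_le g0 dotv_ge0.
split; last by rewrite /mu; lra.
- split => //; last 1 first.
  + move=> ys x miny Ex; rewrite -(uxs _ miny) {ys miny}.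
    have xE : xs + (x - xs) = x by rewrite addrC subrK.
    have growth : f x - f xs <= gamma / 2 * enorm (x - xs) ^+ 2.
      rewrite -{1}xE; apply: (smooth_growth_at_critical_point E) => //.
        by move=> y /C1f[].
      by rewrite xE.
    have := contr _ Ex; rewrite /gd_step addrAC => con.
    have [p0 quad] := contraction_quadratic _ _ _ _ (ltW c0) con.
    rewrite cE2 in quad.
    have main := contraction_rate_bound _ _ _ (sqr_ge0 _) p0 quad.
    have inv_a : a^-1 * dotv (gradient f x) (x - xs)
        = gamma * ((2 - s) * (eta * dotv (gradient f x) (x - xs))) / s ^+ 2.
      rewrite /a cE2; field.
      by rewrite !lt0r_neq0 //; lra.
    suff : 3 / 4 * gamma * enorm (x - xs) ^+ 2
           <= a^-1 * dotv (gradient f x) (x - xs).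
      by rewrite /mu; lra.
    rewrite inv_a ler_pdivlMr ?exprn_gt0 //.
    by have := ler_wpM2l (ltW gamma0) main; lra.
  + by exists (f xs) => _ [y Ey <-]; exact: minxs.
  + by rewrite /mu; lra.
- have -> : a = 1 / 2 * (c / (gamma * eta)) / (1 - s / 2).
    by rewrite /a; field; rewrite !lt0r_neq0 //; lra.
  have q0 : 0 <= 1 / 2 * (c / (gamma * eta)).
    by rewrite mulr_ge0 ?divr_ge0 ?ltW //; lra.
  rewrite ler_pdivlMr //; apply: ler_piMr => //.
  by lra.
Qed.
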